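(* For any positive integers $v,h$ and any integer $a$, $$\#\mathbb{B}_{v,h,a}=\#\mathbb{Y}_{v,h,a}=\frac{1}{v+h}\sum_{d\mid(v+h,v)}\mu\!\left(\frac{d}{(d,a)}\right)\frac{\phi(d)}{\phi\!\left(\frac{d}{(d,a)}\right)}\binom{(v+h)/d}{v/d}.$$
   Context: $\mu$ is the Möbius function, $\phi$ is Euler's totient function, and $(d,a)$ is the greatest common divisor of $d$ and $a$; the sum is over positive divisors $d$ of $\gcd(v+h,v)$. $\mathbb{Y}_{v,h}$ is the set of bit sequences in $\{0,1\}^{v+h}$ with exactly $v$ zeros and $h$ ones; $\mathrm{inv}(\mathbf{x})=\#\{(i,j)\mid i<j,\ x_i>x_j\}$; $\mathbb{Y}_{v,h,a}:=\{\mathbf{x}\in\mathbb{Y}_{v,h}\mid\mathrm{inv}(\mathbf{x})\equiv a\pmod{v+h}\}$. $\mathbb{B}_{v,h,a}:=\{\sigma(\mathbf{x})\mid\mathbf{x}\in\mathbb{Y}_{v,h,a}\}$ where $\sigma(x_1x_2x_3\cdots x_{n-1}x_n):=x_1x_nx_2x_{n-1}x_3\cdots$. *)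

(* Defs.v *)
From mathcomp Require Import all_boot all_order all_algebra.

Set Implicit Arguments.
Unset Strict Implicit.
Unset Printing Implicit Defensive.

Import GRing.Theory Num.Theory.

Local Open Scope nat_scope.

(* [mobius 0] is a junk value, set to 0. *)
Definition mobius (n : nat) : int :=
  if (0 < n) && all (fun p => ~~ (p ^ 2 %| n)) (primes n)
  then ((-1) ^+ size (primes n))%R else 0%R.

(* The bits 0 and 1 are [false] and [true]; below, [tnth x p.2 < tnth x p.1]
   compares them as naturals, through the coercion from bool to nat. *)
Definition inv (n : nat) (x : n.-tuple bool) : nat :=
  #|[set p : 'I_n * 'I_n | (p.1 < p.2) && (tnth x p.2 < tnth x p.1)]|.

(* x_1 x_n x_2 x_(n-1) x_3 ...  With 0-based positions, the even position 2k
   holds x_k and the odd position 2k+1 holds x_(n-1-k); both indices are < n,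
   so the default value of [nth] is never used. *)
Definition sigma (n : nat) (x : n.-tuple bool) : n.-tuple bool :=
  [tuple nth false x (if odd i then n.-1 - i./2 else i./2) | i < n].

Definition Y (v h : nat) : {set (v + h).-tuple bool} :=
  [set x : (v + h).-tuple bool |
    (count_mem false x == v) && (count_mem true x == h)].

Definition Ya (v h : nat) (a : int) : {set (v + h).-tuple bool} :=
  [set x in Y v h | ((inv x)%:Z == a %[mod (v + h)%:Z])%Z].

Definition Ba (v h : nat) (a : int) : {set (v + h).-tuple bool} :=
  [set sigma x | x in Ya v h a].

(* Main.v *)
(* Filtering the condition inv x = a (mod n), n = v + h, by the powers of a
   primitive n-th root of unity turns the count into an average over j < n of the
   values at z^j of the Gaussian binomial coefficient sum_x q^(inv x), twisted
   by z^(-ja).  If q is primitive of order d, the product of the X + q^i for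
   i < n is (X^d - (-1)^d)^(n/d); comparing coefficients, the Gaussian binomial
   is C(n/d, v/d) when d divides v and 0 otherwise.  Collecting the j with z^j
   of order d leaves the Ramanujan sum over the primitive d-th roots, which is
   mu(e) phi(d) / phi(e) with e = d / gcd(d, a). *)
Require Import Defs.
From mathcomp Require Import all_boot all_order all_algebra all_field.
From mathcomp Require Import zify ring.

Set Implicit Arguments.
Unset Strict Implicit.
Unset Printing Implicit Defensive.

Import Order.TTheory GRing.Theory Num.Theory.

Local Open Scope ring_scope.

(** * The Möbius function at a multiple of a prime *)

Lemma mobius_prime_dvd (p m : nat) : prime p -> (p %| m)%N -> mobius (p * m) = 0.
Proof.
move=> p_pr pm; rewrite /mobius; case: (posnP (p * m)%N) => //= pm_gt0.
case: ifP => // /allP/(_ p); rewrite mem_primes p_pr pm_gt0 dvdn_mulr //.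
by move=> /(_ isT)/negP; case; rewrite -mulnn dvdn_mul.
Qed.

Lemma mobius_prime_mul (p m : nat) :
  prime p -> ~~ (p %| m)%N -> mobius (p * m) = - mobius m.
Proof.
move=> p_pr pm; rewrite /mobius muln_gt0 prime_gt0 //=.
have [->|m_gt0] := posnP m; first by rewrite oppr0.
have E : perm_eq (primes (p * m)) (p :: primes m).
  apply: uniq_perm; rewrite ?primes_uniq //=.
    by rewrite mem_primes (negPf pm) !andbF primes_uniq.
  by move=> q; rewrite primesM ?(prime_gt0 p_pr) // primes_prime // !inE.
rewrite (perm_size E) (perm_all _ E) /= exprS mulN1r.
rewrite -mulnn dvdn_pmul2l ?prime_gt0 // pm /=.
rewrite (@eq_in_all _ _ (fun q => ~~ (q ^ 2 %| m)%N)); first by case: ifP; rewrite ?oppr0.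
move=> q; rewrite mem_primes => /and3P[q_pr _ qm] /=; rewrite Gauss_dvdr //.
rewrite coprimeXl // prime_coprime //.
by apply: contraNN pm => qp; rewrite -(eqP (_ : q == p)) // -dvdn_prime2.
Qed.

(** * Rearranging sums over residues *)

Lemma big_nat_divmod (R : Type) (idx : R) (op : Monoid.law idx) (p m : nat)
    (F : nat -> R) :
  \big[op/idx]_(0 <= k < p * m) F k
  = \big[op/idx]_(0 <= i < p) \big[op/idx]_(0 <= l < m) F (i * m + l)%N.
Proof.
rewrite big_nat_mul; apply: eq_bigr => i _.
rewrite -{1}[(i * m)%N]add0n big_addn mulSn addnK.
by apply: eq_bigr => l _; rewrite addnC.
Qed.

Section BigNat.
Variable V : nmodType.

Lemma sum_nat_multiples (d g : nat) (F : nat -> V) : (0 < g)%N ->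
  \sum_(0 <= j < d * g | (g %| j)%N) F j = \sum_(0 <= i < d) F (i * g)%N.
Proof.
move=> g_gt0; rewrite big_mkcond big_nat_divmod /=; apply: eq_bigr => i _.
rewrite big_ltn // addn0 dvdn_mull // big_nat big1 ?addr0 // => l /andP[l0 lg].
by rewrite dvdn_addr ?dvdn_mull // gtnNdvd.
Qed.

(** Multiplication by the unit [u] permutes the residues mod [d] and preserves coprimality to [d],
    while [F] depends only on the residue. *)
Lemma reindex_coprime (d u : nat) (F : nat -> V) : coprime u d ->
  (forall k, F (k %% d)%N = F k) ->
  \sum_(0 <= k < d | coprime k d) F (u * k)%N
  = \sum_(0 <= k < d | coprime k d) F k.
Proof.
case: d => [|d] ud Fmod; first by rewrite !big_geq.
rewrite !big_mkord.
pose f (k : 'I_d.+1) : 'I_d.+1 := inord (u * k %% d.+1)%N.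
have fE k : f k = (u * k %% d.+1)%N :> nat by rewrite inordK ?ltn_mod.
have f_inj : injective f.
  move=> i j /(congr1 val)/eqP; rewrite /= !fE => E; apply/val_inj/eqP => /=.
  wlog ij : i j E / (i <= j)%N.
    by case/orP: (leq_total i j) => [ij|ji] H; [exact: H | rewrite eq_sym H // eq_sym].
  move: E; rewrite eq_sym eqn_mod_dvd ?leq_mul2l ?ij ?orbT // -mulnBr.
  rewrite Gauss_dvdr 1?coprime_sym //.
  move=> dv; rewrite eqn_leq ij -subn_eq0.
  case: posnP dv => // ji_gt0 /(dvdn_leq ji_gt0).
  by rewrite leqNgt (leq_ltn_trans (leq_subr _ _)).
rewrite [RHS](reindex_inj f_inj) /=; apply: eq_big => k.
  by rewrite fE coprime_modl coprimeMl ud.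
by rewrite fE Fmod.
Qed.

(** Group the [j] by [g = gcdn j n] and put [d = n %/ g]: these [j] are the [i * g] with [i < d]
    prime to [d]. *)
Lemma sum_nat_gcd (n : nat) (F : nat -> V) : (0 < n)%N ->
  \sum_(0 <= j < n) F j
  = \sum_(d <- divisors n) \sum_(0 <= i < d | coprime i d) F (i * (n %/ d))%N.
Proof.
move=> n_gt0; transitivity
  (\sum_(d <- divisors n) \sum_(0 <= j < n | gcdn j n == (n %/ d)%N) F j); last first.
  apply: eq_big_seq => d; rewrite -dvdn_divisors // => dn.
  have d_gt0 := dvdn_gt0 n_gt0 dn; have nE := divnK dn.
  set g := (n %/ d)%N in nE *; have g_gt0 : (0 < g)%N by rewrite divn_gt0 // dvdn_leq.
  pose G j := if coprime (j %/ g) d then F j else 0.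
  rewrite -[in LHS]nE (mulnC g) [RHS]big_mkcond.
  transitivity (\sum_(0 <= i < d) G (i * g)%N); last first.
    by apply: eq_bigr => i _; rewrite /G mulnK.
  rewrite -sum_nat_multiples // -big_mkcondr /=; apply: eq_bigl => j.
  have [gj|gj] := boolP (g %| j)%N; last first.
    by apply: contraNF gj => /eqP <-; rewrite dvdn_gcdl.
  by rewrite -{1}(divnK gj) -muln_gcdl -[X in _ == X]mul1n eqn_pmul2r.
under [RHS]eq_bigr do rewrite big_mkcond.
rewrite exchange_big /=; apply: eq_bigr => j _; have gn := dvdn_gcdr j n.
rewrite (bigD1_seq (n %/ gcdn j n)%N) /= ?divisors_uniq //; last first.
  by rewrite -dvdn_divisors // dvdn_div.
rewrite divnA // mulKn // eqxx big1_seq ?addr0 // => d /andP[dg].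
rewrite -dvdn_divisors // => dn; case: eqP => // gE; case/eqP: dg.
by rewrite gE divnA // mulKn.
Qed.

End BigNat.

(** * Sums of roots of unity and Ramanujan sums *)

Section RootsOfUnity.
Variable F : fieldType.

Lemma sum_unity_root (n : nat) (w : F) : w ^+ n = 1 -> w != 1 ->
  \sum_(0 <= i < n) w ^+ i = 0.
Proof.
move=> wn w1; have /esym/eqP := subrX1 w n.
by rewrite wn subrr mulf_eq0 subr_eq0 (negPf w1) -(big_mkord xpredT) => /eqP.
Qed.

(** Write [k = i * m + l]: the condition depends on [l] alone, and the sum over [i] is a full
    geometric sum in [z ^+ m], a root of unity of order [p > 1], hence 0. *)
Lemma sum_coprime_cofactor (p m : nat) (z : F) :
  prime p -> (p * m).-primitive_root z ->
  \sum_(0 <= k < p * m | coprime k m) z ^+ k = 0.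
Proof.
move=> p_pr z_prim; rewrite big_mkcond big_nat_divmod exchange_big /=.
have /andP[_ m_gt0] : (0 < p)%N && (0 < m)%N.
  by rewrite -muln_gt0 (prim_order_gt0 z_prim).
rewrite big1 // => l _.
under eq_bigr do rewrite coprime_sym /coprime gcdnMDl -/(coprime _ _).
case: (coprime m l); last by rewrite big1.
under eq_bigr do rewrite exprD mulnC exprM.
rewrite -mulr_suml sum_unity_root ?mul0r //.
  by rewrite -exprM mulnC (prim_expr_order z_prim).
rewrite -(prim_order_dvd z_prim); apply/negP => /(dvdn_leq m_gt0).
by rewrite -{2}[m]mul1n leq_pmul2r // leqNgt prime_gt1.
Qed.

(* With n = p m, the exponents k < n prime to m form a union of cosets of m
   in Z/n, so the corresponding powers of z sum to 0.  These k are those prime to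
   n if p divides m, and otherwise also the multiples of p, which contribute
   the sum at m. *)
Lemma sum_primitive_roots (n : nat) (z : F) : n.-primitive_root z ->
  \sum_(0 <= k < n | coprime k n) z ^+ k = (mobius n)%:~R.
Proof.
elim/ltn_ind: n z => n IHn z z_prim.
have n_gt0 := prim_order_gt0 z_prim.
have [n_le1|n_gt1] := leqP n 1.
  have -> : n = 1%N by apply/eqP; rewrite eqn_leq n_le1.
  by rewrite big_mkcond big_nat1.
have p_pr := pdiv_prime n_gt1; have p_gt0 := prime_gt0 p_pr.
move: (pdiv n) p_pr p_gt0 (pdiv_dvd n) => p p_pr p_gt0 /dvdnP[m nE].
rewrite mulnC in nE; subst n.
have m_gt0 : (0 < m)%N by move: n_gt0; rewrite muln_gt0 => /andP[].
have S0 := sum_coprime_cofactor p_pr z_prim.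
have [pm|pm] := boolP (p %| m)%N.
  rewrite mobius_prime_dvd // -[RHS]S0; apply: eq_bigl => k.
  rewrite coprimeMr; case/dvdnP: pm => r ->; rewrite coprimeMr.
  by rewrite andbCA andbb.
rewrite mobius_prime_mul // rmorphN /= -(IHn m _ (z ^+ p)); first last.
- by have := dvdn_prim_root z_prim (dvdn_mull p (dvdnn m)); rewrite mulnK.
- by rewrite -{1}[m]mul1n ltn_pmul2r // prime_gt1.
apply/eqP; rewrite -addr_eq0 -[X in _ == X]S0; apply/eqP.
rewrite [RHS](bigID (fun k => coprime k p)) /=; congr (_ + _).
  by apply: eq_bigl => k; rewrite coprimeMr andbC.
rewrite mulnC [RHS](eq_bigl (fun k => (p %| k)%N && coprime k m)); last first.
  by move=> k; rewrite (coprime_sym k p) (prime_coprime _ p_pr) negbK andbC.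
rewrite big_mkcondr /= sum_nat_multiples // [LHS]big_mkcond /=.
apply: eq_bigr => i _; rewrite coprimeMl (prime_coprime _ p_pr) pm.
by rewrite andbT mulnC exprM.
Qed.

(** Take [u = t * e + j], with [t] the part of [d] at the primes not dividing [j]. Each prime factor
    of [d] divides exactly one of [t * e] and [j], hence not [u]. *)
Lemma coprime_lift (e d j : nat) : (0 < d)%N -> (e %| d)%N -> coprime j e ->
  exists2 u, coprime u d & u = j %[mod e].
Proof.
move=> d_gt0 ed je; pose pi : nat_pred := [pred p | ~~ (p %| j)%N].
exists (d`_pi * e + j)%N; last by rewrite modnMDl.
have t_dvd p : prime p -> (p %| d)%N -> (p %| d`_pi)%N = ~~ (p %| j)%N.
  move=> p_pr pd; have := mem_primes p d`_pi; rewrite p_pr part_gt0 /= => <-.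
  by rewrite primes_part mem_filter mem_primes p_pr d_gt0 pd !andbT !inE.
rewrite /coprime eqn_leq gcdn_gt0 d_gt0 orbT andbT leqNgt.
apply/negP => /pdivP[p p_pr]; rewrite dvdn_gcd => /andP[pu pd].
move: pu; have [pj|pj] := boolP (p %| j)%N; last first.
  by rewrite dvdn_addr ?(negPf pj) // dvdn_mulr // t_dvd.
rewrite dvdn_addl // Euclid_dvdM // t_dvd // pj /= => pe.
by have := coprime_dvdl pj je; rewrite prime_coprime // pe.
Qed.

Lemma sum_nat1_coprime (n : nat) :
  \sum_(0 <= k < n | coprime k n) 1 = (totient n)%:R :> F.
Proof.
rewrite totient_count_coprime natr_sum big_mkcond.
by apply: eq_bigr => k _; rewrite coprime_sym; case: coprime.
Qed.

(* With w = z^c, primitive of order e, replacing w by w^j for j prime to e does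
   not change the sum, as j lifts to a unit mod d.  Summing over all such j
   first turns each w^k into a sum of primitive e-th roots. *)
Lemma ramanujan_sum (d c : nat) (z : F) : d.-primitive_root z ->
  (totient (d %/ gcdn d c))%:R *
    \sum_(0 <= k < d | coprime k d) z ^+ (k * c)
  = (totient d)%:R * (mobius (d %/ gcdn d c))%:~R.
Proof.
move=> z_prim; have d_gt0 := prim_order_gt0 z_prim.
set e := (d %/ _)%N; set w := z ^+ c.
have ed : (e %| d)%N by rewrite dvdn_div ?dvdn_gcdl.
have w_prim : e.-primitive_root w by rewrite /e gcdnC exp_prim_root.
have wmod k : w ^+ (k %% e) = w ^+ k by rewrite (expr_mod _ (prim_expr_order w_prim)).
transitivity (\sum_(0 <= j < e | coprime j e)
                \sum_(0 <= k < d | coprime k d) w ^+ (j * k)).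
  rewrite -sum_nat1_coprime mulr_suml; apply: eq_bigr => j je.
  have [u ud uj] := coprime_lift d_gt0 ed je.
  have F_mod k : w ^+ (k %% d) = w ^+ k.
    by rewrite -wmod modn_dvdm // wmod.
  rewrite mul1r; transitivity (\sum_(0 <= k < d | coprime k d) w ^+ (u * k)).
    rewrite (reindex_coprime ud F_mod).
    by apply: eq_bigr => k _; rewrite mulnC exprM.
  by apply: eq_bigr => k _; rewrite -wmod -modnMml uj modnMml wmod.
rewrite exchange_big /= -sum_nat1_coprime mulr_suml; apply: eq_bigr => k kd.
rewrite mul1r -(sum_primitive_roots w_prim).
rewrite -(reindex_coprime (coprime_dvdr ed kd) wmod).
by apply: eq_bigr => j _; rewrite mulnC.
Qed.
End RootsOfUnity.

(** * The map [sigma] and the inversion statistic *)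

Lemma sigma_inj (n : nat) : injective (@sigma n).
Proof.
move=> x y xy; apply: eq_from_tnth => i; rewrite !(tnth_nth false).
have E (k : 'I_n) := congr1 (fun t => tnth t k) xy.
(* Entry [i] of [x] is found in [sigma x] at position [2i] if that is below [n], and otherwise at
   position [2(n - 1 - i) + 1]. *)
have [lt_in|le_ni] := ltnP i.*2 n.
  have := E (Ordinal lt_in); rewrite !tnth_mktuple /= odd_double /= doubleK //.
have lt_kn : ((n.-1 - i).*2.+1 < n)%N by have := ltn_ord i; lia.
have := E (Ordinal lt_kn); rewrite !tnth_mktuple /= odd_double /= uphalf_double.
by rewrite subKn //; have := ltn_ord i; lia.
Qed.

(** Among the ordered pairs of elements of [A], [#|A|] are diagonal, and the others split evenly
    between [i < j] and [j < i]. *)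
Lemma sum_ltn_pairs (n : nat) (A : pred 'I_n) :
  (\sum_(j | A j) \sum_(i | A i) (i < j) = 'C(#|A|, 2))%N.
Proof.
set S := (\sum_(j | _) _)%N.
have E : (#|A| * #|A| = S + S + #|A|)%N.
  rewrite -{1 3}sum1_card big_distrl /= {2}/S exchange_big -!big_split /=.
  apply: eq_bigr => j Aj; rewrite mul1n -sum1_card.
  rewrite -[X in (_ + _ + X)%N](_ : \sum_(i | A i) (i == j) = 1)%N.
    rewrite -!big_split; apply: eq_bigr => i _ /=.
    by rewrite -(inj_eq val_inj) /=; case: ltngtP.
  rewrite (bigD1 j) //= eqxx big1 // => i /andP[_ ij].
  by rewrite (negPf ij).
rewrite bin2; suff -> : (#|A| * #|A|.-1 = S.*2)%N by rewrite doubleK.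
by rewrite -subn1 mulnBr muln1 E addnK addnn.
Qed.

Lemma count_tnth (T : Type) (n : nat) (P : pred T) (x : n.-tuple T) :
  count P x = #|[pred i | P (tnth x i)]|.
Proof. by rewrite -sum1_count big_tuple sum1_card. Qed.

(* Both sides sum, over the positions j of a 0, the number of i < j: those
   carrying a 1 are the inversions, those carrying a 0 are counted by the
   binomial coefficient. *)
Lemma inv_sum_positions (n : nat) (x : n.-tuple bool) :
  (Defs.inv x + 'C(count_mem false x, 2) = \sum_(i < n | ~~ tnth x i) i)%N.
Proof.
pose A := [pred i | ~~ tnth x i].
have -> : count_mem false x = #|A|.
  by rewrite count_tnth; apply: eq_card => i; rewrite !inE eqbF_neg.
rewrite -sum_ltn_pairs.
have -> : Defs.inv x = (\sum_(j | A j) \sum_(i | ~~ A i) (i < j))%N.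
  transitivity (\sum_j \sum_i [&& A j, ~~ A i & i < j])%N.
    rewrite exchange_big pair_bigA /Defs.inv -sum1_card big_mkcond.
    apply: eq_bigr => -[i j] _; rewrite !inE /= negbK andbC.
    by case: (tnth x i); case: (tnth x j); case: (i < j)%N.
  rewrite [RHS]big_mkcond; apply: eq_bigr => j _.
  case: (A j) => /=; last by rewrite big1.
  by rewrite [RHS]big_mkcond; apply: eq_bigr => i _; case: (~~ A i).
rewrite -big_split; apply: eq_bigr => j _ /=.
rewrite addnC -(bigID A xpredT) /= -big_mkcond.
by rewrite -(big_ord_widen _ (fun=> 1%N)) ?sum1_card ?card_ord // ltnW.
Qed.

(** * Gaussian binomial coefficients at roots of unity *)

Section GaussianBinomial.
Variable F : fieldType.

(** Substitute [- 'X] in the factorization of ['X^d - 1] and multiply by [(-1) ^+ d]. *)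
Lemma prod_X_add_root (d : nat) (q : F) : d.-primitive_root q ->
  \prod_(0 <= i < d) ('X + (q ^+ i)%:P) = 'X^d - ((-1) ^+ d)%:P.
Proof.
move=> q_prim.
have /(congr1 (fun p : {poly F} =>
  \prod_(0 <= i < d) (-1) * (p \Po - 'X))) := factor_Xn_sub_1 q_prim.
rewrite rmorph_prod -big_split prodr_const_nat subn0 /=.
rewrite comp_polyB comp_polyC comp_Xn_poly mulrBr -exprMn mulrNN mul1r mulr1.
rewrite polyC_exp polyCN => <-.
apply: eq_bigr => i _; rewrite comp_polyB comp_polyX comp_polyC.
by rewrite mulN1r opprB opprK addrC.
Qed.

(** Expand the product: a bit 1 at position [i] selects ['X] from factor [i], a bit 0 selects
    [q ^+ i]. *)
Lemma sum_tuple_prod (n : nat) (q : F) :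
  \prod_(0 <= i < n) ('X + (q ^+ i)%:P)
  = \sum_(x : n.-tuple bool)
      q ^+ (\sum_(i < n | ~~ tnth x i) i) *: 'X^(count_mem true x).
Proof.
pose G (i : 'I_n) (b : bool) : {poly F} := if b then 'X else (q ^+ i)%:P.
rewrite big_mkord (eq_bigr (fun i => \sum_b G i b)) => [|i _]; last first.
  by rewrite big_bool.
rewrite bigA_distr_bigA (reindex (fun x : n.-tuple bool => [ffun i => tnth x i])) /=.
  apply: eq_bigr => x _; rewrite (bigID (fun i => tnth x i)) /= mulrC -mul_polyC.
  rewrite expr_sum rmorph_prod count_tnth -prodr_const; congr (_ * _).
    by apply: eq_bigr => i xi; rewrite /G ffunE (negPf xi).
  by apply: eq_big => i; rewrite ?inE ?eqb_id // => xi; rewrite /G ffunE xi.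
apply: onW_bij; exists (fun f : {ffun 'I_n -> bool} => [tuple f i | i < n]) => x.
  by apply: eq_from_tnth => i; rewrite tnth_mktuple ffunE.
by apply/ffunP => i; rewrite ffunE tnth_mktuple.
Qed.

(** For odd [d], [d] divides the exponent and both sides are 1. For even [d], [q ^+ d./2 = -1] and
    the exponent is [d./2 * s * (d * s - 1)] with an odd last factor. *)
Lemma prim_root_exp_bin2 (d s : nat) (q : F) : d.-primitive_root q ->
  q ^+ 'C(d * s, 2) = (- (-1) ^+ d) ^+ s.
Proof.
move=> q_prim; have d_gt0 := prim_order_gt0 q_prim.
have [->|s_gt0] := posnP s; first by rewrite muln0.
have dE := odd_double_half d; move: dE; case: (boolP (odd d)) => d_odd /= dE.
  rewrite -signr_odd d_odd expr1 opprK expr1n; apply/eqP.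
  rewrite -(prim_order_dvd q_prim) -(@Gauss_dvdr _ 2) ?coprimen2 //.
  by rewrite -mul_bin_diag bin1 -mulnA dvdn_mulr.
have q_half : q ^+ d./2 = -1.
  have := prim_expr_order q_prim; rewrite -{1}dE add0n -muln2 exprM => /eqP.
  rewrite sqrf_eq1 => /orP[|/eqP //].
  by rewrite -(prim_order_dvd q_prim) => /dvdn_leq; lia.
have -> : 'C(d * s, 2) = (d./2 * (s * (d * s).-1))%N.
  rewrite bin2 -{1}dE add0n -muln2 -!mulnA mulnCA mul2n doubleK.
  by rewrite mulnA.
rewrite exprM q_half -(signr_odd _ d) (negPf d_odd) expr0 -[RHS]signr_odd.
rewrite -[LHS]signr_odd oddM -subn1 oddB ?muln_gt0 ?d_gt0 // oddM.
by rewrite (negPf d_odd) andbT.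
Qed.

Lemma sum_inv_root_unity (v h d : nat) (q : F) :
    d.-primitive_root q -> (d %| v + h)%N ->
  \sum_(x in Y v h) q ^+ Defs.inv x
  = (if (d %| v)%N then 'C((v + h) %/ d, v %/ d) else 0%N)%:R.
Proof.
move=> q_prim dn; have d_gt0 := prim_order_gt0 q_prim.
have q0 : q != 0 by rewrite (prim_root_eq0 q_prim) -lt0n.
set m := ((v + h) %/ d)%N; have nE : (m * d = v + h)%N by rewrite divnK.
(* The factor [q ^+ 'C(v, 2)] turns [inv x] into the sum of the positions of the zeros; it later
   cancels the sign of the coefficient. *)
apply: (mulfI (expf_neq0 'C(v, 2) q0)); rewrite mulr_sumr.
transitivity ((\prod_(0 <= i < v + h) ('X + (q ^+ i)%:P))`_h).
  rewrite sum_tuple_prod coef_sum big_mkcond; apply: eq_bigr => x _.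
  rewrite coefZ coefXn inE.
  have := count_predC (pred1 false) x; rewrite size_tuple.
  rewrite (@eq_count _ (predC (pred1 false)) (pred1 true)); last by case.
  have [<-|] := eqVneq h (count_mem true x); last first.
    by rewrite andbF mulr0.
  move/eqP; rewrite eqn_add2r => /eqP cv.
  by rewrite cv !eqxx mulr1 -exprD -inv_sum_positions cv addnC.
(* Cut the range into [m] blocks of length [d]; since [q ^+ d = 1], all blocks give the same
   product. *)
rewrite -nE big_nat_divmod /=.
rewrite (eq_bigr (fun=> 'X^d - ((-1) ^+ d)%:P)) => [|i _]; last first.
  rewrite -(prod_X_add_root q_prim); apply: eq_bigr => l _.
  by rewrite exprD mulnC exprM (prim_expr_order q_prim) expr1n mul1r.
rewrite prodr_const_nat subn0 exprDn coef_sum.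
transitivity (\sum_(i < m.+1)
    if (d * i == v)%N then (- (-1) ^+ d) ^+ i *+ 'C(m, i) else 0 : F).
  apply: eq_bigr => i _; rewrite -polyCN -polyC_exp coefMn coefMC -exprM coefXn.
  have im := ltn_ord i.
  (* Here [d * m = v + h] and [i <= m], so the truncated subtraction is exact. *)
  have -> : (h == d * (m - i))%N = (d * i == v)%N by nia.
  by case: ifP => _; rewrite ?mul1r // mul0r mul0rn.
have [/dvdnP[s]|dv] := boolP (d %| v)%N; last first.
  rewrite mulr0 big1 // => i _; case: eqP => // vE.
  by rewrite -vE dvdn_mulr in dv.
rewrite mulnC => vE; have sm : (s < m.+1)%N by nia.
rewrite (bigD1 (Ordinal sm)) //= vE eqxx big1 ?addr0 => [|i].
  by rewrite (prim_root_exp_bin2 _ q_prim) mulKn // mulr_natr.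
rewrite eqn_pmul2l // => /eqP ne; case: eqP => // iE.
by case: ne; apply/val_inj.
Qed.

End GaussianBinomial.

(** * The root of unity filter and the count *)

Lemma card_Ya_sum (v h : nat) (a : int) (z : algC) :
    (0 < v)%N -> (v + h).-primitive_root z ->
  (v + h)%:R * #|Ya v h a|%:R =
  \sum_(d <- divisors (gcdn (v + h) v))
     (mobius (d %/ gcdn d `|a|%N))%:~R *
     ((totient d)%:R / (totient (d %/ gcdn d `|a|%N))%:R) *
     ('C((v + h) %/ d, v %/ d))%:R :> algC.
Proof.
move=> v_gt0; set n := (v + h)%N => z_prim; have n_gt0 := prim_order_gt0 z_prim.
(* A natural representative of -a, so that no negative exponent occurs. *)
pose c := `|(- a %% n%:Z)%Z|%N.
have cE : c%:Z = (- a %% n%:Z)%Z.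
  by rewrite gez0_abs // modz_ge0 // -lt0n.
have Ya_dvd (x : n.-tuple bool) : ((Defs.inv x)%:Z == a %[mod n%:Z])%Z = (n %| Defs.inv x + c)%N.
  rewrite eqz_mod_dvd -[RHS]/(n%:Z %| (Defs.inv x + c)%N%:Z)%Z PoszD cE.
  by apply/dvdz_mod0P/dvdz_mod0P; rewrite modzDmr.
(* [c] is congruent to [- a] mod [n], hence mod every divisor [d], and the gcd ignores signs. *)
have gcd_c d : (d %| n)%N -> gcdn d `|a|%N = gcdn d c.
  case/dvdnP=> k nE; have := gcdzMDl ((- a %/ n%:Z)%Z * k%:Z) d%:Z c%:Z.
  by rewrite -mulrA -PoszM -nE cE -divz_eq gcdzN -cE => -[].
(* For fixed [x], the powers of [z ^+ (inv x + c)] add up to [n] if [n] divides [inv x + c], and to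
   0 otherwise. *)
transitivity (\sum_(0 <= j < n) \sum_(x in Y v h) z ^+ (j * (Defs.inv x + c))).
  rewrite exchange_big /= -sumr_const mulr_sumr.
  rewrite (eq_bigl (fun x => (x \in Y v h) && (n %| Defs.inv x + c)%N)); last first.
    by move=> x; rewrite inE Ya_dvd.
  rewrite big_mkcondr; apply: eq_bigr => x _; rewrite mulr1.
  rewrite (prim_order_dvd z_prim); under [RHS]eq_bigr do rewrite mulnC exprM.
  case: eqP => [->|/eqP w1].
    by under eq_bigr do rewrite expr1n; rewrite sumr_const_nat subn0.
  by rewrite sum_unity_root // -exprM mulnC exprM (prim_expr_order z_prim) expr1n.
rewrite sum_nat_gcd //.
(* All the [z ^+ (i * (n %/ d))] with [i] prime to [d] have order [d], so they share one Gaussian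
   binomial value, which factors out. *)
transitivity (\sum_(d <- divisors n | (d %| v)%N)
   'C(n %/ d, v %/ d)%:R * \sum_(0 <= i < d | coprime i d) (z ^+ (n %/ d)) ^+ (i * c)).
  rewrite [RHS]big_mkcond; apply: eq_big_seq => d.
  rewrite -dvdn_divisors // => dn; have zd_prim := dvdn_prim_root z_prim dn.
  transitivity (\sum_(0 <= i < d | coprime i d)
     (z ^+ (n %/ d)) ^+ (i * c) * (if (d %| v)%N then 'C(n %/ d, v %/ d) else 0%N)%:R).
    apply: eq_bigr => i id_coprime.
    have q_prim : d.-primitive_root ((z ^+ (n %/ d)) ^+ i) by rewrite prim_root_exp_coprime.
    rewrite -(sum_inv_root_unity q_prim dn) mulr_sumr; apply: eq_bigr => x _.
    by rewrite -!exprM -exprD; congr (_ ^+ _); ring.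
  by rewrite -mulr_suml mulrC; case: ifP => // _; rewrite mul0r.
rewrite -big_filter; transitivity (\sum_(d <- divisors (gcdn n v))
   'C(n %/ d, v %/ d)%:R * \sum_(0 <= i < d | coprime i d) (z ^+ (n %/ d)) ^+ (i * c)).
  apply: perm_big; apply: uniq_perm; rewrite ?filter_uniq ?divisors_uniq // => d.
  by rewrite mem_filter -!dvdn_divisors ?gcdn_gt0 ?n_gt0 // dvdn_gcd andbC.
apply: eq_big_seq => d.
rewrite -dvdn_divisors ?gcdn_gt0 ?n_gt0 // dvdn_gcd => /andP[dn dv].
have d_gt0 := dvdn_gt0 n_gt0 dn; have zd_prim := dvdn_prim_root z_prim dn.
rewrite mulrC gcd_c //; congr (_ * _).
have := ramanujan_sum c zd_prim; set e := (d %/ _)%N.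
have e_neq0 : (totient e)%:R != 0 :> algC.
  rewrite pnatr_eq0 -lt0n totient_gt0 divn_gt0 ?gcdn_gt0 ?d_gt0 //.
  by rewrite dvdn_leq ?dvdn_gcdl.
move=> E; apply: (mulfI e_neq0); rewrite E; field.
exact: e_neq0.
Qed.

Theorem theorem10p2 (v h : nat) (a : int) (hv : (0 < v)%N) (hh : (0 < h)%N) :
  #|Ba v h a| = #|Ya v h a| /\
  (#|Ya v h a|%:R =
   ((v + h)%N%:R)^-1 *
   \sum_(d <- divisors (gcdn (v + h) v))
     (mobius (d %/ gcdn d `|a|%N))%:~R *
     ((totient d)%:R / (totient (d %/ gcdn d `|a|%N))%:R) *
     ('C((v + h) %/ d, v %/ d))%:R :> rat)%R.
Proof.
split; first by rewrite card_imset //; apply: sigma_inj.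
have n_gt0 : (0 < v + h)%N by rewrite addn_gt0 hv.
have [z z_prim] := C_prim_root_exists n_gt0.
have n_neq0 : (v + h)%:R != 0 :> rat by rewrite pnatr_eq0 -lt0n.
apply: (mulfI n_neq0); rewrite mulVKf //.
(* Both sides are rational, so they may be compared in [algC], where [z] lives. *)
apply: (fmorph_inj (@ratr algC)); rewrite rmorphM !rmorph_nat.
rewrite (card_Ya_sum a hv z_prim) rmorph_sum; apply: eq_bigr => d _.
by rewrite !rmorphM fmorphV !rmorph_nat rmorph_int.
Qed.
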